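(* Let $X$ be a non-empty set and let $(X,\sigma,\tau)$ be a non-degenerate distributive solution of the Yang–Baxter equation, and let $k>1$ be an integer. Then $(X,\sigma,\tau)$ is a multipermutation solution of level at most $k$ if and only if the Yang–Baxter group of $(X,\sigma,\tau)$ is nilpotent of class at most $k-1$.
   Context: A (set-theoretic) solution of the Yang–Baxter equation is a set $X$ with two mappings $\sigma,\tau:X\times X\to X$ such that $r:X^2\to X^2$, $r(x,y)=(\sigma(x,y),\tau(x,y))$, satisfies the braid relation $(\mathrm{id}\times r)(r\times \mathrm{id})(\mathrm{id}\times r)=(r\times \mathrm{id})(\mathrm{id}\times r)(r\times \mathrm{id})$ on $X^3$. Write $\sigma_x(y)=\sigma(x,y)$ and $\tau_y(x)=\tau(x,y)$. The solution is non-degenerate if all maps $\sigma_x:X\to X$ and $\tau_y:X\to X$ ($x,y\in X$) are bijections. The Yang–Baxter group of a non-degenerate solution $(X,\sigma,\tau)$ is the group of permutations of $X$ generated by all $\sigma_x$ and $\tau_x$, $x\in X$. The solution is distributive if for every element $\eta$ of its Yang–Baxter group and every $x\in X$: $\eta\sigma_x=\sigma_{\eta(x)}\eta$ and $\eta\tau_x=\tau_{\eta(x)}\eta$. On $X$ define $x\approx y$ iff $\sigma_x=\sigma_y$ and $\tau_x=\tau_y$. The retraction $\mathrm{Ret}(X)$ is the solution on the quotient set $X/\mathord{\approx}$ induced by $\sigma$ and $\tau$, i.e. with $\sigma([x],[y])=[\sigma(x,y)]$ and $\tau([x],[y])=[\tau(x,y)]$ (this is well defined and is again a non-degenerate solution).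 Put $\mathrm{Ret}^0(X)=X$ and $\mathrm{Ret}^{j}(X)=\mathrm{Ret}(\mathrm{Ret}^{j-1}(X))$ for $j\ge 1$. $X$ is a multipermutation solution of level $j$ if $j$ is the smallest non-negative integer with $|\mathrm{Ret}^j(X)|=1$. Nilpotency class: $\gamma_0(G)=G$, $\gamma_i(G)=[\gamma_{i-1}(G),G]$ for $i\ge1$; $G$ is nilpotent of class $j$ if $j$ is the smallest number with $\gamma_j(G)=\{1\}$ (so class $0$ means trivial). *)

(* Defs.v *)
From HB Require Import structures.
From mathcomp Require Import all_boot.
From mathcomp Require Import boolp classical_sets.

Set Implicit Arguments.
Unset Strict Implicit.
Unset Printing Implicit Defensive.

Local Open Scope classical_set_scope.

(** * Permutations of an arbitrary set *)

Record sym (X : Type) := Sym {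
  sym_fun :> X -> X;
  sym_inv : X -> X;
  sym_funK : cancel sym_fun sym_inv;
  sym_invK : cancel sym_inv sym_fun }.

Lemma symP (X : Type) (p q : sym X) : p =1 q -> p = q.
Proof.
case: p q => [f f' fK f'K] [g g' gK g'K] /= /funext eqfg; subst g.
have e : f' = g' by apply: funext => x; rewrite -{1}[x]g'K fK.
by subst g'; congr Sym; exact: Prop_irrelevance.
Qed.

Section SymGroup.
Variable X : Type.
Implicit Types p q : sym X.

HB.instance Definition _ := gen_eqMixin (sym X).
HB.instance Definition _ := gen_choiceMixin (sym X).

Definition sym_one : sym X := @Sym X id id (frefl id) (frefl id).

Definition sym_mul p q : sym X :=
  @Sym X (p \o q) (sym_inv q \o sym_inv p)
    (can_comp (sym_funK p) (sym_funK q))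
    (can_comp (sym_invK q) (sym_invK p)).

Definition sym_opp p : sym X :=
  @Sym X (sym_inv p) p (sym_invK p) (sym_funK p).

Fact sym_mulA : associative sym_mul.
Proof. by move=> p q s; apply: symP. Qed.
Fact sym_1mul : left_id sym_one sym_mul.
Proof. by move=> p; apply: symP. Qed.
Fact sym_mul1 : right_id sym_one sym_mul.
Proof. by move=> p; apply: symP. Qed.
Fact sym_Vmul : left_inverse sym_one sym_opp sym_mul.
Proof. by move=> p; apply: symP => x; exact: sym_funK. Qed.
Fact sym_mulV : right_inverse sym_one sym_opp sym_mul.
Proof. by move=> p; apply: symP => x; exact: sym_invK. Qed.

HB.instance Definition _ := isGroup.Build (sym X)
  sym_mulA sym_1mul sym_mul1 sym_Vmul sym_mulV.
End SymGroup.

(** * Subgroups of a possibly infinite group and nilpotency *)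

Section Nilpotency.
Local Open Scope group_scope.
Variable gT : groupType.
Implicit Types A B G H : set gT.

Definition subgroup H : Prop :=
  [/\ H 1, (forall x y, H x -> H y -> H (x * y))
    & (forall x, H x -> H x^-1)].

Definition generated A : set gT := smallest subgroup A.

Definition commutator_subgroup A B : set gT :=
  generated [set z | exists x y, [/\ A x, B y & z = [~ x, y]]].

Fixpoint lower_central G (i : nat) : set gT :=
  if i is j.+1 then commutator_subgroup (lower_central G j) G else G.

Definition nilpotent_of_class G (j : nat) : Prop :=
  lower_central G j = [set 1] /\
  (forall i, (i < j)%N -> lower_central G i <> [set 1]).

Definition nilpotent_of_class_at_most G (m : nat) : Prop :=
  exists2 j, (j <= m)%N & nilpotent_of_class G j.
End Nilpotency.

(** * Set-theoretic solutions of the Yang-Baxter equation *)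

(* The bare data of a map r(x, y) = (sigma(x, y), tau(x, y)); the axioms are
   separate predicates, so that the retraction can be iterated on the data. *)
Record ybdata := YBData {
  carrier :> Type;
  sigma : carrier -> carrier -> carrier;
  tau : carrier -> carrier -> carrier }.

Section Solutions.
Variable S : ybdata.

Definition ybmap (u : S * S) : S * S := (sigma u.1 u.2, tau u.1 u.2).

Definition r_id (u : S * S * S) : S * S * S :=
  let: (x, y, z) := u in let: (x', y') := ybmap (x, y) in (x', y', z).

Definition id_r (u : S * S * S) : S * S * S :=
  let: (x, y, z) := u in let: (y', z') := ybmap (y, z) in (x, y', z').

Definition yb_solution : Prop :=
  id_r \o r_id \o id_r = r_id \o id_r \o r_id.

Definition sigma_ (x : S) : S -> S := fun y => sigma x y.
(* The index of tau is the second argument. *)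
Definition tau_ (y : S) : S -> S := fun x => tau x y.

Definition nondegenerate : Prop :=
  (forall x, bijective (sigma_ x)) /\ (forall y, bijective (tau_ y)).

Definition YB_group : set (sym S) :=
  generated [set p : sym S |
    exists x, (p : S -> S) = sigma_ x \/ (p : S -> S) = tau_ x].

Definition distributive_solution : Prop :=
  forall eta : sym S, YB_group eta -> forall x,
    eta \o sigma_ x = sigma_ (eta x) \o eta /\
    eta \o tau_ x = tau_ (eta x) \o eta.

(** * Retraction *)

Definition ret_rel (x y : S) : Prop := sigma_ x = sigma_ y /\ tau_ x = tau_ y.

Definition ret_relb : rel {classic S} := fun x y => `[< ret_rel x y >].

Fact ret_relb_refl : reflexive ret_relb.
Proof. by move=> x; apply/asboolP. Qed.
Fact ret_relb_sym : symmetric ret_relb.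
Proof. by move=> x y; apply/asboolP/asboolP => -[e e']; split. Qed.
Fact ret_relb_trans : transitive ret_relb.
Proof.
move=> y x z /asboolP[xy xy'] /asboolP[yz yz']; apply/asboolP.
by split; [rewrite xy | rewrite xy'].
Qed.

Canonical ret_equiv :=
  EquivRel ret_relb ret_relb_refl ret_relb_sym ret_relb_trans.

Definition ret_carrier : Type := {eq_quot ret_equiv}%qT.
Definition ret_class (x : S) : ret_carrier := (\pi_({eq_quot ret_equiv}) x)%qT.
Definition ret_repr (c : ret_carrier) : S := repr (c : {eq_quot ret_equiv}%qT).

(* The induced operations, computed on chosen representatives; [Ret_sigmaE] and
   [Ret_tauE] below show that the choice is irrelevant. *)
Definition Ret : ybdata := YBData
  (fun c d : ret_carrier => ret_class (sigma (ret_repr c) (ret_repr d)))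
  (fun c d : ret_carrier => ret_class (tau (ret_repr c) (ret_repr d))).

Lemma ret_classP (x y : S) : ret_class x = ret_class y <-> ret_rel x y.
Proof.
split=> [/eqP|xy]; first by rewrite /ret_class eqmodE => /asboolP.
by apply/eqP; rewrite /ret_class eqmodE; apply/asboolP.
Qed.

Lemma ret_reprP (x : S) : ret_rel (ret_repr (ret_class x)) x.
Proof. by apply/ret_classP; rewrite /ret_class /ret_repr reprK. Qed.

Lemma ret_rel_congr (x x' y y' : S) : yb_solution -> nondegenerate ->
  ret_rel x x' -> ret_rel y y' ->
  ret_rel (sigma x y) (sigma x' y') /\ ret_rel (tau x y) (tau x' y').
Proof.
move=> yb [sbij tbij] [sx tx] [sy ty].
have braid a b c := congr1 (fun f => f (a, b, c)) yb.
have B1 a b : sigma_ a \o sigma_ b = sigma_ (sigma a b) \o sigma_ (tau a b).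
  by apply: funext => c; case: (braid a b c).
have B3 a b : tau_ a \o tau_ b = tau_ (tau b a) \o tau_ (sigma b a).
  by apply: funext => c; case: (braid c b a).
have surj (f g h : S -> S) : bijective h -> f \o h = g \o h -> f = g.
  by case=> h' _ hK e; apply: funext => c; rewrite -[c]hK; exact: (congr1 (@^~ _) e).
have inj (f g h : S -> S) : bijective h -> h \o f = h \o g -> f = g.
  by case=> h' hK _ e; apply: funext => c; apply: (can_inj hK);
    exact: (congr1 (@^~ c) e).
have es b : sigma x b = sigma x' b := congr1 (@^~ b) sx.
have et b : tau b x = tau b x' := congr1 (@^~ b) tx.
have es' b : sigma y b = sigma y' b := congr1 (@^~ b) sy.
have et' b : tau b y = tau b y' := congr1 (@^~ b) ty.
split; split.
- rewrite -es; apply: (surj _ _ (sigma_ (tau x y)) (sbij _)).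
  by rewrite -B1 {1}sy B1 et'.
- rewrite -es; apply: (inj _ _ (tau_ (tau x y)) (tbij _)).
  by rewrite -B3 {1}ty B3 et'.
- rewrite -et'; apply: (inj _ _ (sigma_ (sigma x y)) (sbij _)).
  by rewrite -B1 {1}sx B1 es.
- rewrite -et'; apply: (surj _ _ (tau_ (sigma x y)) (tbij _)).
  by rewrite -B3 {1}tx B3 es.
Qed.

Lemma Ret_sigmaE (x y : S) : yb_solution -> nondegenerate ->
  @sigma Ret (ret_class x) (ret_class y) = ret_class (sigma x y).
Proof.
move=> yb nd; apply/ret_classP.
by have [] := ret_rel_congr yb nd (ret_reprP x) (ret_reprP y).
Qed.

Lemma Ret_tauE (x y : S) : yb_solution -> nondegenerate ->
  @tau Ret (ret_class x) (ret_class y) = ret_class (tau x y).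
Proof.
move=> yb nd; apply/ret_classP.
by have [] := ret_rel_congr yb nd (ret_reprP x) (ret_reprP y).
Qed.
End Solutions.
Arguments YB_group S : clear implicits.

Definition one_element (T : Type) : Prop := exists x : T, forall y : T, y = x.

Definition multipermutation_of_level (S : ybdata) (j : nat) : Prop :=
  one_element (iter j Ret S) /\
  (forall i, (i < j)%N -> ~ one_element (iter i Ret S)).

Definition multipermutation_of_level_at_most (S : ybdata) (m : nat) : Prop :=
  exists2 j, (j <= m)%N & multipermutation_of_level S j.

(* Main.v *)
Require Import Defs.
From mathcomp Require Import all_boot.
From mathcomp Require Import boolp classical_sets.

(** Let [G] be the Yang-Baxter group and [p_j : X -> Ret^j(X)] the projection.
    Distributivity makes the kernels of the [p_j] invariant under [G], and it
    turns the relation [p_(j+1) (g x) = p_(j+1) x] into the commutation of [g]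
    with [sigma_x] and [tau_x] modulo the kernel of the action on [Ret^j(X)].
    Hence the subgroup of [G] acting trivially on [Ret^j(X)] is the [j]-th term
    of the upper central series of [G].  The braid relation moreover forces
    every [sigma_a] to commute with every [tau_b]; this gives, for [j > 0],
    that [Ret^(j+1)(X)] is a point iff [G] acts trivially on [Ret^j(X)]. *)

Set Implicit Arguments.
Unset Strict Implicit.
Unset Printing Implicit Defensive.

Local Open Scope classical_set_scope.

(** * Least indices, and the upper and lower central series *)

(** Serves to discard the minimality clause in both the level and the class: a one-element
    retraction and a trivial lower central term persist at all later indices. *)
Lemma least_at_most (P : nat -> Prop) (m : nat) : (forall i, P i -> P i.+1) ->
  (exists2 j, (j <= m)%N & P j /\ forall i, (i < j)%N -> ~ P i) <-> P m.
Proof.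
move=> Pmono; split=> [[j /subnK <- [Pj _]]|Pm].
  by elim: (m - j)%N => // n; rewrite addSn; apply: Pmono.
have exP : exists n, `[< P n >] by exists m; apply/asboolP.
case: (ex_minnP exP) => j /asboolP Pj minj.
exists j; first by apply: minj; apply/asboolP.
by split=> // i ltij /asboolP /minj; rewrite leqNgt ltij.
Qed.

Lemma inj_surj_bij (A B : Type) (f : A -> B) :
  injective f -> (forall y, exists x, f x = y) -> bijective f.
Proof.
move=> finj fsurj; pose g y := projT1 (cid (fsurj y)).
have gK : cancel g f by move=> y; rewrite /g; case: cid.
by exists g => // x; apply: finj; rewrite gK.
Qed.

Section LowerCentral.
Local Open Scope group_scope.
Variable gT : groupType.
Implicit Types A G H : set gT.

Lemma generated_subgroup A : subgroup (generated A).
Proof.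
split=> [H [[]] //|x y Ax Ay H HA|x Ax H HA].
  by have [[_ HM _] _] := HA; apply: HM; [apply: Ax|apply: Ay].
by have [[_ _ HV] _] := HA; apply: HV; apply: Ax.
Qed.

Lemma subgroup1 : subgroup [set 1 : gT].
Proof.
by split=> [|x y|x] /=; [|move=> -> ->; rewrite mulg1|move=> ->; rewrite invg1].
Qed.

Lemma lower_central_subgroup G i : subgroup G -> subgroup (lower_central G i).
Proof. by case: i => //= i _; apply: generated_subgroup. Qed.

Lemma subgroupR G x y : subgroup G -> G x -> G y -> G [~ x, y].
Proof.
move=> [_ GM GV] Gx Gy; rewrite commgEl conjgE.
by apply: (GM); [apply: GV|apply: (GM); [apply: GV|apply: GM]].
Qed.

Lemma lower_central_sub G i : subgroup G -> lower_central G i `<=` G.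
Proof.
move=> sG; elim: i => //= i IHi; apply: smallest_sub => // _ [x [y [Lx Gy ->]]].
by apply: subgroupR => //; apply: IHi.
Qed.

Lemma lower_central_eq1S G i :
  lower_central G i = [set 1] -> lower_central G i.+1 = [set 1].
Proof.
move=> /= ->; apply/seteqP; split.
  apply: smallest_sub; first exact: subgroup1.
  by move=> _ [x [y [/= -> _ ->]]]; rewrite comm1g.
by move=> _ /= ->; have [] := generated_subgroup
  [set z | exists x y, [/\ [set 1] x, G y & z = [~ x, y]]].
Qed.

(** The recursion makes the sets [Z i] cut out the upper central series inside [G]. Both directions
    rest on [lower_central G i] lying in [Z (m - i)], proved by induction from opposite ends: from
    [i = 0] when [G] lies in [Z m], from [i = m] when [lower_central G m] is trivial. *)
Lemma upper_lower_central G (Z : nat -> set gT) m : subgroup G ->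
  (forall i, subgroup (Z i)) -> Z 0%N = [set 1] ->
  (forall i x, G x -> Z i.+1 x <-> forall y, G y -> Z i [~ x, y]) ->
  G `<=` Z m <-> lower_central G m = [set 1].
Proof.
move=> sG sZ Z0 ZS; split=> [GZ|L1].
  apply/seteqP; split; last first.
    by move=> _ /= ->; have [] := lower_central_subgroup m sG.
  rewrite -Z0 -(subnn m).
  suff H i : (i <= m)%N -> lower_central G i `<=` Z (m - i)%N by exact: H.
  elim: i => [|i IHi] ltim; first by rewrite subn0.
  rewrite /=; apply: smallest_sub => // _ [x [y [Lx Gy ->]]].
  have Gx := lower_central_sub sG Lx.
  move: y Gy; have [+ _] := ZS (m - i.+1)%N x Gx; apply.
  by rewrite subnSK //; apply: (IHi (ltnW ltim)).
suff H i : (i <= m)%N -> lower_central G (m - i)%N `<=` Z i.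
  by have := H m (leqnn m); rewrite subnn.
elim: i => [|i IHi] ltim; first by rewrite subn0 L1 Z0.
move=> x Lx; apply/ZS; first exact: lower_central_sub Lx.
move=> y Gy; apply: IHi; first exact: ltnW.
by rewrite -subnSK //=; apply: sub_gen_smallest; exists x, y.
Qed.
End LowerCentral.

(** * Identities in a distributive solution *)

Section Distributive.
Variable S : ybdata.
Hypotheses (yb : yb_solution S) (nd : nondegenerate S)
           (dist : distributive_solution S).
Local Notation G := (YB_group S).

Let GG : subgroup G. Proof. exact: generated_subgroup. Qed.

Lemma sigma_perm x : exists2 s : sym S, G s & (s : S -> S) = sigma_ x.
Proof.
have [g fK gK] := nd.1 x; exists (Sym fK gK) => //.
by apply: sub_gen_smallest; exists x; left.
Qed.

Lemma tau_perm x : exists2 s : sym S, G s & (s : S -> S) = tau_ x.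
Proof.
have [g fK gK] := nd.2 x; exists (Sym fK gK) => //.
by apply: sub_gen_smallest; exists x; right.
Qed.

Lemma YB_group_ind (H : set (sym S)) : subgroup H ->
  (forall (g : sym S) x, G g -> (g : S -> S) = sigma_ x -> H g) ->
  (forall (g : sym S) x, G g -> (g : S -> S) = tau_ x -> H g) -> G `<=` H.
Proof.
move=> sH Hs Ht; apply: smallest_sub => // g [x gx].
have Gg : G g by apply: sub_gen_smallest; exists x.
by case: gx; [apply: Hs|apply: Ht].
Qed.

Lemma YB_act_sigma (g : sym S) (x y : S) : G g -> g (sigma x y) = sigma (g x) (g y).
Proof. by move=> /dist/(_ x)[/(congr1 (@^~ y))]. Qed.

Lemma YB_act_tau (g : sym S) (x y : S) : G g -> g (tau y x) = tau (g y) (g x).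
Proof. by move=> /dist/(_ x)[_ /(congr1 (@^~ y))]. Qed.

Lemma sigma_sigma (a b c : S) : sigma a (sigma b c) = sigma (sigma a b) (sigma a c).
Proof.
have [s Gs es] := sigma_perm a.
by have := YB_act_sigma b c Gs; rewrite es.
Qed.

Lemma tau_tau (a b c : S) : tau (tau c b) a = tau (tau c a) (tau b a).
Proof.
have [s Gs es] := tau_perm a.
by have := YB_act_tau b c Gs; rewrite es.
Qed.

(** Self-distributivity gives [sigma_x sigma_x = sigma_(sigma x x) sigma_x]; cancel the bijection
    [sigma_x] on the right. *)
Lemma sigma_diag (x : S) : sigma_ (sigma x x) = sigma_ x.
Proof.
apply: funext => w; have [g _ gK] := nd.1 x.
by rewrite -(gK w) /sigma_ -sigma_sigma.
Qed.

Lemma tau_diag (x : S) : tau_ (tau x x) = tau_ x.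
Proof.
apply: funext => w; have [g _ gK] := nd.2 x.
by rewrite -(gK w) /tau_ -tau_tau.
Qed.

(* By the braid relation and distributivity,
   [sigma_a sigma_b = sigma_(sigma a b) sigma_(tau a b)
                    = sigma_a sigma_b sigma_a^-1 sigma_(tau a b)]. *)
Lemma sigma_tau (a b : S) : sigma_ (tau a b) = sigma_ a.
Proof.
apply: funext => c; have [g sK _] := nd.1 (sigma a b); apply: (can_inj sK).
have [e _ _] := congr1 (fun f => f (a, b, c)) yb.
by rewrite /sigma_ -sigma_sigma; apply: esym.
Qed.

(** Mirror image of [sigma_tau], from the third component of the braid relation. By distributivity
    it amounts to [sigma_b] commuting with [tau_a]. *)
Lemma tau_sigma (a b : S) : tau_ (sigma b a) = tau_ a.
Proof.
apply: funext => c; have [g tK _] := nd.2 (tau b a); apply: (can_inj tK).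
have [_ _ e] := congr1 (fun f => f (c, b, a)) yb.
by rewrite /tau_ -tau_tau.
Qed.

(** * Quotients on which the Yang-Baxter group acts *)

(** The last condition lets the group of [S] itself act on [T], so one group serves for all iterated
    retractions. *)
Definition YB_quotient (T : ybdata) (p : S -> T) : Prop :=
  [/\ forall y, exists x, p x = y,
      forall x y, p (sigma x y) = sigma (p x) (p y),
      forall x y, p (tau x y) = tau (p x) (p y)
    & forall g : sym S, G g -> forall x y, p x = p y -> p (g x) = p (g y)].

Definition YB_kernel (T : ybdata) (p : S -> T) : set (sym S) :=
  [set g | G g /\ forall x, p (g x) = p x].

Lemma YB_quotient_yb (T : ybdata) (p : S -> T) : YB_quotient p -> yb_solution T.
Proof.
move=> [psurj ps pt _]; apply: funext => -[[a b] c].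
have [[x <-] [y <-] [z <-]] := And3 (psurj a) (psurj b) (psurj c).
have [e1 e2 e3] := congr1 (fun f => f (x, y, z)) yb.
rewrite /id_r /r_id /ybmap /= -!(ps, pt).
by congr (p _, p _, p _).
Qed.

(** [sigma_ (p x)] is the map induced on [T] by an element [s] of [G]; since [s^-1] also preserves
    the fibres of [p], it induces the inverse. The same holds for [tau]. *)
Lemma YB_quotient_nd (T : ybdata) (p : S -> T) :
  YB_quotient p -> nondegenerate T.
Proof.
move=> [psurj ps pt pG]; have [_ _ GV] := GG; split=> a.
  have [x <-] := psurj a; have [s Gs es] := sigma_perm x.
  have ps' z : p (s z) = sigma (p x) (p z) by rewrite es ps.
  apply: inj_surj_bij => [b c|b]; rewrite /sigma_.
    have [[y <-] [z <-]] := (psurj b, psurj c).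
    by rewrite -!ps' => /(pG _ (GV _ Gs)); rewrite /= !sym_funK.
  by have [y <-] := psurj b; exists (p (sym_inv s y)); rewrite -ps' sym_invK.
have [x <-] := psurj a; have [s Gs es] := tau_perm x.
have pt' z : p (s z) = tau (p z) (p x) by rewrite es pt.
apply: inj_surj_bij => [b c|b]; rewrite /tau_.
  have [[y <-] [z <-]] := (psurj b, psurj c).
  by rewrite -!pt' => /(pG _ (GV _ Gs)); rewrite /= !sym_funK.
by have [y <-] := psurj b; exists (p (sym_inv s y)); rewrite -pt' sym_invK.
Qed.

Lemma ret_class_surj (T : ybdata) (c : ret_carrier T) :
  exists x, ret_class x = c.
Proof. by exists (ret_repr c); rewrite /ret_class /ret_repr reprK. Qed.

Lemma ret_class_eq (T : ybdata) (p : S -> T) x y : YB_quotient p ->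
  ret_class (p x) = ret_class (p y) <->
  forall z, p (sigma x z) = p (sigma y z) /\ p (tau z x) = p (tau z y).
Proof.
move=> [psurj ps pt _]; split=> [/ret_classP [es et] z|e].
  by rewrite !ps !pt; split; [exact: (congr1 (@^~ (p z)) es)
                             |exact: (congr1 (@^~ (p z)) et)].
apply/ret_classP; split; apply: funext => c; have [z <-] := psurj c.
  by rewrite /sigma_ -!ps; have [] := e z.
by rewrite /tau_ -!pt; have [] := e z.
Qed.

Lemma YB_quotient_id : YB_quotient (@id S).
Proof. by split=> // [y|g _ x y ->]; first by exists y. Qed.

Lemma YB_quotient_ret (T : ybdata) (p : S -> T) :
  YB_quotient p -> @YB_quotient (Ret T) (fun x => ret_class (p x)).
Proof.
move=> qp; have [psurj ps pt pG] := qp.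
have [ybT ndT] := (YB_quotient_yb qp, YB_quotient_nd qp).
split=> [c|x y|x y|g Gg x y /(ret_class_eq _ _ qp) e].
- have [a <-] := ret_class_surj c; have [x <-] := psurj a.
  by exists x.
- by rewrite ps Ret_sigmaE.
- by rewrite pt Ret_tauE.
(* Writing [z = g z'], distributivity turns [sigma (g x) z] into [g (sigma x z')], and similarly for
   [tau]. *)
apply/(ret_class_eq _ _ qp) => z; have [es et] := e (sym_inv g z).
rewrite -(sym_invK g z) -!YB_act_sigma // -!YB_act_tau //.
by split; apply: pG.
Qed.

Lemma YB_kernel_subgroup (T : ybdata) (p : S -> T) :
  YB_quotient p -> subgroup (YB_kernel p).
Proof.
move=> [_ _ _ pG]; have [G1 GM GV] := GG.
split=> [|g h [Gg pg] [Gh ph]|g [Gg pg]]; split=> //; try by auto.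
  by move=> x; rewrite /= pg ph.
by move=> x; rewrite -[RHS](congr1 p (sym_invK g x)) pg.
Qed.

Lemma YB_kernel_comm (T : ybdata) (p : S -> T) (g h : sym S) :
    YB_quotient p -> G g -> G h ->
  YB_kernel p [~ g, h]%g <-> forall x, p (g (h x)) = p (h (g x)).
Proof.
move=> [_ _ _ pG] Gg Gh; have [_ _ GV] := GG.
have commE x : [~ g, h]%g x = sym_inv g (sym_inv h (g (h x))) by [].
split=> [[_ e] x|e].
  have := pG _ Gh _ _ (pG _ Gg _ _ (e x)).
  by rewrite commE !sym_invK.
split=> [|x]; first exact: (subgroupR GG Gg Gh).
have := pG _ (GV _ Gg) _ _ (pG _ (GV _ Gh) _ _ (e x)).
by rewrite commE /= !sym_funK.
Qed.

(** By distributivity [sigma_(g x) = g sigma_x g^-1], so [g] fixes the class of [p x] iff it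
    commutes with [sigma_x] and [tau_x] modulo the kernel on [T]. This is the recursion of the upper
    central series. *)
Lemma YB_kernel_ret (T : ybdata) (p : S -> T) (g : sym S) :
    YB_quotient p -> G g ->
  @YB_kernel (Ret T) (fun x => ret_class (p x)) g <->
  forall h, G h -> YB_kernel p [~ g, h]%g.
Proof.
move=> qp Gg; have [_ _ _ pG] := qp; have [G1 GM GV] := GG.
split=> [[_ e] h Gh|e]; last first.
  have {}e h x : G h -> p (g (h x)) = p (h (g x)).
    by move=> Gh; have [+ _] := YB_kernel_comm qp Gg Gh; apply; apply: e.
  split=> // x; apply/(ret_class_eq _ _ qp) => z.
  rewrite -(sym_invK g z) -YB_act_sigma // -YB_act_tau //.
  have [[s Gs es] [t Gt et]] := (sigma_perm x, tau_perm x).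
  by split; [have := e s (sym_inv g z) Gs; rewrite es
            |have := e t (sym_inv g z) Gt; rewrite et].
have {}e x z : p (g (sigma x z)) = p (sigma x (g z)) /\
               p (g (tau z x)) = p (tau (g z) x).
  rewrite YB_act_sigma // YB_act_tau //.
  by have /(ret_class_eq _ _ qp) := e x; apply.
apply/YB_kernel_comm => //; move: h Gh.
(* [C] is the centralizer of [g] modulo the kernel on [T]; being a subgroup, it need only contain
   the generators. *)
pose C := [set h | G h /\ forall x, p (g (h x)) = p (h (g x))].
suff : G `<=` C by move=> GC h /GC [].
apply: YB_group_ind => [|h x Gh eh|h x Gh eh].
- split=> [//|h k [Gh ch] [Gk ck]|h [Gh ch]]; split=> //; try by auto.
    by move=> x; rewrite /= ch; apply: pG.
  move=> x; have := ch (sym_inv h x).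
  by rewrite sym_invK => /(pG _ (GV _ Gh)); rewrite /= sym_funK.
- by split=> // z; rewrite eh; have [] := e x z.
- by split=> // z; rewrite eh; have [] := e x z.
Qed.

(** * Iterated retractions and the central series *)

Fixpoint ret_proj (j : nat) : S -> iter j Ret S :=
  match j return S -> iter j Ret S with
  | 0 => id
  | i.+1 => fun x => ret_class (ret_proj i x)
  end.

Lemma ret_proj_quotient j : YB_quotient (ret_proj j).
Proof.
by elim: j => [|j IHj]; [apply: YB_quotient_id|apply: YB_quotient_ret].
Qed.

Lemma YB_kernel_lower_central m :
  G `<=` YB_kernel (ret_proj m) <-> lower_central G m = [set 1%g].
Proof.
apply: (@upper_lower_central _ G (fun j => YB_kernel (ret_proj j))) => //.
- by move=> j; apply/YB_kernel_subgroup/ret_proj_quotient.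
- have [G1 _ _] := GG; apply/seteqP; split=> [g [_ e]|_ -> //].
  exact: symP.
- by move=> j g Gg; apply: YB_kernel_ret (ret_proj_quotient j) Gg.
Qed.

(** The index starts at [m.+1] because the analogue at [0] fails: if every [sigma_x] is one
    nontrivial permutation and every [tau_x] is the identity, the retraction is a point but the
    group is not trivial. *)
Lemma YB_kernel_one_element m : inhabited S ->
  G `<=` YB_kernel (ret_proj m.+1) <-> one_element (iter m.+2 Ret S).
Proof.
move=> [x0]; have q1 := ret_proj_quotient m.+1.
have q0 := ret_proj_quotient m.
split=> [GK|[c all_c]].
  exists (ret_proj m.+2 x0) => c.
  have [psurj _ _ _] := ret_proj_quotient m.+2.
  have [x <-] := psurj c; apply/(ret_class_eq _ _ q1) => z.
  (* All translations of this retraction are the identity, so the next one merges all points. *)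
  have sE y : ret_proj m.+1 (sigma y z) = ret_proj m.+1 z.
    by have [s /GK[_ e] es] := sigma_perm y; have := e z; rewrite es.
  have tE y : ret_proj m.+1 (tau z y) = ret_proj m.+1 z.
    by have [s /GK[_ e] es] := tau_perm y; have := e z; rewrite es.
  by rewrite !sE !tE.
have {all_c}all_eq x y : ret_proj m.+2 x = ret_proj m.+2 y.
  by rewrite (all_c (ret_proj m.+2 x)) (all_c (ret_proj m.+2 y)).
(* Comparing with the diagonal: [sigma x z ~ sigma z z], and [sigma_diag],
   [tau_sigma] identify the latter with [z] one retraction further. *)
have retE x y : ret_rel x y -> ret_proj m.+1 x = ret_proj m.+1 y.
  move=> [es et]; apply/(ret_class_eq _ _ q0) => w.
  by split; [congr ret_proj; exact: (congr1 (@^~ w) es)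
            |congr ret_proj; exact: (congr1 (@^~ w) et)].
apply: YB_group_ind => [|g x Gg eg|g x Gg eg].
- exact: YB_kernel_subgroup.
- split=> // z; rewrite eg /sigma_.
  have /(ret_class_eq _ _ q1)/(_ z)[-> _] := all_eq x z.
  by apply: retE; split; [apply: sigma_diag|apply: tau_sigma].
- split=> // z; rewrite eg /tau_.
  have /(ret_class_eq _ _ q1)/(_ z)[_ ->] := all_eq x z.
  by apply: retE; split; [apply: sigma_tau|apply: tau_diag].
Qed.
End Distributive.

Lemma one_element_Ret (S : ybdata) : one_element S -> one_element (Ret S).
Proof.
move=> [x all_x]; exists (ret_class x) => c.
by have [y <-] := ret_class_surj c; rewrite (all_x y).
Qed.

Theorem mainTheorem1 (X : Type) (sigma tau : X -> X -> X) (k : nat) :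
  let S := YBData sigma tau in
  inhabited X ->
  yb_solution S ->
  nondegenerate S ->
  distributive_solution S ->
  (1 < k)%N ->
  multipermutation_of_level_at_most S k <->
  nilpotent_of_class_at_most (YB_group S) (k - 1)%N.
Proof.
move=> S inhX yb nd dist; case: k => [|[|m]] // _; rewrite subn1 /=.
(* With [k = m.+2], both sides are compared with the trivial action of the group on the retraction
   of index [m.+1]. *)
have level := least_at_most (P := fun j => one_element (iter j Ret S)) m.+2
  (fun j => @one_element_Ret (iter j Ret S)).
have nil_class := least_at_most
  (P := fun j => lower_central (YB_group S) j = [set 1%g]) m.+1
  (@lower_central_eq1S _ (YB_group S)).
apply: (iff_trans level); apply: iff_trans (iff_sym nil_class).
apply: iff_trans (YB_kernel_lower_central yb nd dist m.+1).
exact: iff_sym (YB_kernel_one_element yb nd dist m inhX).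
Qed.
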